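(* Let $K$ be a positive even integer, $J\ge 0$ a real number and $\epsilon>0$. Let $|\Psi\rangle\in(\mathbb C^2)^{\otimes K}$ be a unit vector chosen uniformly at random (according to the unitarily invariant probability measure on pure states), and let $F^{(K,J)}_\Psi:=\langle\Psi|\,\mathcal E^{(K)}_J(|\Psi\rangle\langle\Psi|)\,|\Psi\rangle$. Then $$\mathrm{Prob}\big[F^{(K,J)}_\Psi<1-\epsilon\big]<\frac{2(K+1)}{\epsilon}\exp\!\Big[-\frac{2J^2}{K}\Big].$$
   Context: For $K$ qubits, decompose $(\mathbb C^2)^{\otimes K}\cong\bigoplus_{j=0}^{K/2}\mathcal R_j\otimes\mathcal M_{jK}$ (Schur–Weyl decomposition), where $j$ is the total angular momentum quantum number, $\mathcal R_j$ carries the spin-$j$ irreducible representation of $SU(2)$ (dimension $2j+1$) and $\mathcal M_{jK}$ is the multiplicity space, of dimension $m_{jK}=\frac{2j+1}{K/2+j+1}\binom{K}{K/2+j}$; equivalently $\mathcal R_j\otimes\mathcal M_{jK}$ is the eigenspace of the total squared angular momentum $\big(\sum_{k=1}^K \sigma^{(k)}/2\big)^2$ with eigenvalue $j(j+1)$. Let $P^{(K)}_J$ be the orthogonal projector onto $\mathcal H^{(K)}_J:=\bigoplus_{j\le J}\mathcal R_j\otimes\mathcal M_{jK}$, and fix a density matrix $\rho_0$ supported in $\mathcal H^{(K)}_J$. The encoding channel is $\mathcal E^{(K)}_J(\rho):=P^{(K)}_J\rho P^{(K)}_J+\mathrm{Tr}[(I^{\otimes K}-P^{(K)}_J)\rho]\,\rho_0$.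 *)

(* Defs.v *)
From HB Require Import structures.
From mathcomp Require Import all_boot all_order all_algebra.
From mathcomp Require Import all_classical all_reals all_analysis.
From mathcomp.real_closed Require Import complex.

Set Implicit Arguments.
Unset Strict Implicit.
Unset Printing Implicit Defensive.

Import Order.TTheory GRing.Theory Num.Theory.
Local Open Scope ring_scope.
Local Open Scope classical_set_scope.

Section QubitDefs.
Variable R : realType.
Local Notation C := R[i].

(* conjugate transpose *)
Definition mxadj m n (A : 'M[C]_(m, n)) : 'M[C]_(n, m) :=
  (map_mx (fun x : C => x^*) A)^T.

(* Pauli matrices sigma_x, sigma_y, sigma_z (a = 0, 1, 2) *)
Definition pauli (a : 'I_3) : 'M[C]_2 :=
  \matrix_(r < 2, c < 2)
    match val a with
    | 0%N => if r != c then 1 else 0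
    | 1%N => if r == c then 0 else if (val r == 0%N) then - 'i%C else 'i%C
    | _ => if r == c then (if val r == 0%N then 1 else -1) else 0
    end.

(* bit k of the computational-basis index i; qubit k <-> bit k *)
Definition qbit (i : nat) (k : nat) : bool := odd (i %/ 2 ^ k).

(* sigma^{(k)} : the single-qubit operator s acting on qubit k of K qubits,
   i.e. I (x) ... (x) s (x) ... (x) I, written entrywise. *)
Definition on_qubit (K : nat) (k : 'I_K) (s : 'M[C]_2) : 'M[C]_(2 ^ K) :=
  \matrix_(i < 2 ^ K, j < 2 ^ K)
    if [forall m : 'I_K, (m != k) ==> (qbit i m == qbit j m)]
    then s (inord (qbit i k)) (inord (qbit j k)) else 0.

(* total angular momentum components  sum_k sigma_a^{(k)} / 2 *)
Definition Stot (K : nat) (a : 'I_3) : 'M[C]_(2 ^ K) :=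
  \sum_(k < K) (2%:R^-1) *: on_qubit k (pauli a).

(* total squared angular momentum *)
Definition S2 (K : nat) : 'M[C]_(2 ^ K) := \sum_(a < 3) (Stot K a *m Stot K a).

(* H^{(K)}_J = direct sum over j in {0,...,K/2}, j <= J, of the eigenspaces
   of S2 with eigenvalue j(j+1) *)
Definition in_HJ (K : nat) (J : R) (v : 'cV[C]_(2 ^ K)) : Prop :=
  exists vs : 'I_(K./2).+1 -> 'cV[C]_(2 ^ K),
    v = \sum_(j < (K./2).+1 | (j%:R <= J)) vs j /\
    forall j : 'I_(K./2).+1, j%:R <= J ->
      S2 K *m vs j = (j * j.+1)%:R *: vs j.

(* P is the orthogonal projector onto the subspace W *)
Definition orth_proj n (P : 'M[C]_n) (W : 'cV[C]_n -> Prop) : Prop :=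
  [/\ mxadj P = P, P *m P = P & forall v, W v <-> P *m v = v].

(* density matrix: Hermitian, positive semidefinite, unit trace *)
Definition density n (rho : 'M[C]_n) : Prop :=
  [/\ mxadj rho = rho,
      forall v : 'cV[C]_n, 0 <= (mxadj v *m rho *m v) 0 0
    & \tr rho = 1].

(* encoding channel E_J(rho) = P rho P + Tr[(I - P) rho] rho0 *)
Definition enc n (P rho0 rho : 'M[C]_n) : 'M[C]_n :=
  P *m rho *m P + (\tr ((1%:M - P) *m rho)) *: rho0.

(* F_Psi = <Psi| E(|Psi><Psi|) |Psi> *)
Definition fidelity n (P rho0 : 'M[C]_n) (psi : 'cV[C]_n) : C :=
  (mxadj psi *m enc P rho0 (psi *m mxadj psi) *m psi) 0 0.

Definition unitary n (U : 'M[C]_n) : Prop := mxadj U *m U = 1%:M.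

(* Borel sigma-algebra on C^n = R^(2n): generated by the real and imaginary
   parts of the coordinates *)
Definition coord_gen n : set (set 'cV[C]_n) :=
  [set S | exists (i : 'I_n) (b : bool) (A : set R),
     measurable A /\
     S = [set v : 'cV[C]_n |
           A ((if b then @complex.Re R else @complex.Im R) (v i 0))]].

(* carrier of the sample space: C^n (pointed by 0, needed by the library) *)
Definition cvec n := 'cV[C]_n.
HB.instance Definition _ n := Choice.on (cvec n).
HB.instance Definition _ n := isPointed.Build (cvec n) 0.

Definition vecT n := g_sigma_algebraType (@coord_gen n : set (set (cvec n))).

(* unitarily invariant probability measure on pure states (unit vectors) *)
Definition uniform_pure n (mu : probability (vecT n) R) : Prop :=
  mu [set v : vecT n | (mxadj v *m v) 0 0 = 1] = 1%E /\
  forall U : 'M[C]_n, unitary U ->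
    forall A : set (vecT n), measurable A ->
      mu ((fun v : vecT n => (U *m v : vecT n)) @^-1` A) = mu A.

End QubitDefs.

(* Main.v *)
(* Writing q = <psi|Q|psi> with Q = 1 - P, the fidelity of a unit vector is at least
   (1 - q)^2 >= 1 - 2 q, so Markov's inequality bounds the probability by (2/eps) E[q], and
   E[q] = tr Q / 2^K by unitary invariance.

   To bound tr Q, split along the eigenspaces of S_z.  Q commutes with S_x, S_y, S_z, and
   S^2 = S_- S_+ + S_z^2 + S_z, so a vector of weight m killed by S_+ is an eigenvector of S^2
   for m (m + 1).  As the range of Q is orthogonal to all eigenspaces with j <= J, the raising
   operator is injective on the weight-m part of this range unless m > J or -m - 1 > J.  Hence
   each of these K + 1 parts has dimension at most that of a full weight space with |m| > J,
   which is below 2^K exp(- 2 J^2 / K) by Chernoff's bound. *)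

Require Import Defs.
From HB Require Import structures.
From mathcomp Require Import all_boot all_order fingroup perm all_algebra.
From mathcomp Require Import all_classical all_reals all_analysis.
From mathcomp.real_closed Require Import complex.
From mathcomp Require Import measurable_realfun ring lra.

Import Order.TTheory GRing.Theory Num.Theory numFieldNormedType.Exports.
Local Open Scope ring_scope.
Local Open Scope classical_set_scope.

Set Implicit Arguments.
Unset Strict Implicit.
Unset Printing Implicit Defensive.

(** * Operators acting on single qubits *)

(** Bit 0 is the parity, and bit [k + 1] of a number is bit [k] of its half, which allows induction
    on [K]. *)
Lemma qbit_inj (K i j : nat) : (i < 2 ^ K)%N -> (j < 2 ^ K)%N ->
  (forall k, (k < K)%N -> qbit i k = qbit j k) -> i = j.
Proof.
elim: K i j => [|K IH] i j; first by case: i; case: j.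
move=> iK jK eqij; have qS a k : qbit a k.+1 = qbit a./2 k.
  by rewrite /qbit expnS divnMA divn2.
have := eqij 0%N isT; rewrite /qbit !divn1 => eq0.
suff: i./2 = j./2 by move=> eqh; rewrite -(odd_double_half i) -(odd_double_half j) eq0 eqh.
have half_lt a : (a < 2 ^ K.+1)%N -> (a./2 < 2 ^ K)%N.
  by rewrite expnS -divn2 ltn_divLR// mulnC.
by apply: IH; [exact: half_lt|exact: half_lt|move=> k kK; rewrite -!qS; exact: eqij].
Qed.

Definition bits (K : nat) (i : 'I_(2 ^ K)) : {ffun 'I_K -> bool} :=
  [ffun k : 'I_K => qbit i k].

Lemma bits_inj (K : nat) : injective (@bits K).
Proof.
move=> i j /ffunP eqij; apply/val_inj/(@qbit_inj K); [exact: ltn_ord.. |move=> k kK].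
by have := eqij (Ordinal kK); rewrite !ffunE.
Qed.

Lemma bits_bij (K : nat) : bijective (@bits K).
Proof.
apply: inj_card_bij; first exact: bits_inj.
by rewrite card_ffun card_bool !card_ord.
Qed.

(** Every bit string belongs to some index because [bits] is bijective; [setbit] then picks the
    index by choice, without arithmetic on powers of two. *)
Lemma setbit_subproof (K : nat) (i : 'I_(2 ^ K)) (k : 'I_K) (b : bool) :
  exists j : 'I_(2 ^ K), bits j == [ffun m => if m == k then b else bits i m].
Proof. by have [g _ gK] := bits_bij K; exists (g [ffun m => if m == k then b else bits i m]); rewrite gK. Qed.

Definition setbit (K : nat) (i : 'I_(2 ^ K)) (k : 'I_K) (b : bool) : 'I_(2 ^ K) :=
  xchoose (setbit_subproof i k b).

Lemma qbit_setbit (K : nat) (i : 'I_(2 ^ K)) (k m : 'I_K) (b : bool) :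
  qbit (setbit i k b) m = if m == k then b else qbit i m.
Proof.
have /eqP/ffunP/(_ m) := xchooseP (setbit_subproof i k b).
by rewrite !ffunE.
Qed.

(** This is the test inside [on_qubit], named so that [on_qubitE] holds by unfolding. *)
Definition eq_off (K : nat) (k : 'I_K) (i j : 'I_(2 ^ K)) :=
  [forall m : 'I_K, (m != k) ==> (qbit i m == qbit j m)].

Lemma eq_offP (K : nat) (k : 'I_K) (i j : 'I_(2 ^ K)) :
  reflect (exists b, j = setbit i k b) (eq_off k i j).
Proof.
apply: (iffP forallP) => [eqij|[b ->] m]; last first.
  by apply/implyP => mk; rewrite qbit_setbit (negPf mk).
exists (qbit j k); apply: bits_inj; apply/ffunP => m; rewrite !ffunE qbit_setbit.
by case: eqVneq => [->//|mk]; have := eqij m; rewrite mk => /eqP.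
Qed.

Lemma eq_off_sym (K : nat) (k : 'I_K) (i j : 'I_(2 ^ K)) : eq_off k i j = eq_off k j i.
Proof. by apply: eq_forallb => m; rewrite [qbit i m == _]eq_sym. Qed.

Section Qubits.
Variable R : realType.
Local Notation C := R[i].

Lemma sum_eq_off (K : nat) (k : 'I_K) (i : 'I_(2 ^ K)) (F : 'I_(2 ^ K) -> C) :
  \sum_(j | eq_off k i j) F j = \sum_(b : bool) F (setbit i k b).
Proof.
rewrite (reindex_onto (setbit i k) (fun j : 'I_(2 ^ K) => qbit j k)); last first.
  by move=> j /eq_offP [b ->]; rewrite qbit_setbit eqxx.
apply: eq_bigl => b; rewrite qbit_setbit eqxx eqxx andbT.
by apply/eq_offP; exists b.
Qed.

Lemma eq_off_setbit (K : nat) (k : 'I_K) (i j : 'I_(2 ^ K)) b :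
  eq_off k (setbit i k b) j = eq_off k i j.
Proof.
by apply: eq_forallb => m; rewrite qbit_setbit; case: (m == k).
Qed.

Lemma on_qubitE (K : nat) (k : 'I_K) (s : 'M[C]_2) i j :
  on_qubit k s i j =
  if eq_off k i j then s (inord (qbit i k)) (inord (qbit j k)) else 0.
Proof. by rewrite mxE. Qed.

(** Row [i] of a single-qubit operator is supported on the two indices that agree with [i] off qubit
    [k]. *)
Lemma on_qubit_mulmxE (K : nat) p (k : 'I_K) (s : 'M[C]_2) (A : 'M[C]_(2 ^ K, p)) i j :
  (on_qubit k s *m A) i j =
  \sum_(b : bool) s (inord (qbit i k)) (inord b) * A (setbit i k b) j.
Proof.
rewrite mxE; under eq_bigr do rewrite on_qubitE.
rewrite (bigID (eq_off k i)) /= [X in _ + X]big1 ?addr0; last first.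
  by move=> l /negPf ->; rewrite mul0r.
under eq_bigr => l -> do [].
rewrite (sum_eq_off k i (fun l => s (inord (qbit i k)) (inord (qbit l k)) * A l j)).
by apply: eq_bigr => b _; rewrite qbit_setbit eqxx.
Qed.

Lemma sum_bool_ord2 (F : 'I_2 -> C) : \sum_(b : bool) F (inord b) = \sum_(c < 2) F c.
Proof.
rewrite big_bool /= !big_ord_recl big_ord0 addr0 addrC.
by congr (F _ + F _); apply: val_inj; rewrite /= inordK.
Qed.

Lemma on_qubitM (K : nat) (k : 'I_K) (s t : 'M[C]_2) :
  on_qubit k s *m on_qubit k t = on_qubit k (s *m t).
Proof.
apply/matrixP => i j; rewrite on_qubit_mulmxE on_qubitE.
under eq_bigr do rewrite on_qubitE eq_off_setbit qbit_setbit eqxx.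
case: ifP => _; last by rewrite big1 // => b _; rewrite mulr0.
by rewrite mxE (sum_bool_ord2 (fun c => s _ c * t c _)).
Qed.

Lemma on_qubit_linear (K : nat) (k : 'I_K) : linear (@on_qubit R K k).
Proof.
move=> a s t; apply/matrixP => i j; rewrite !mxE.
by case: ifP => _; rewrite ?mulr0 ?addr0.
Qed.

HB.instance Definition _ K k :=
  GRing.isLinear.Build C 'M[C]_2 'M[C]_(2 ^ K) _ (@on_qubit R K k) (@on_qubit_linear K k).

(** The formula is symmetric under exchanging the two qubits with their operators, which makes
    commutation immediate. *)
Lemma on_qubitMM (K : nat) (k l : 'I_K) (s t : 'M[C]_2) i j : k != l ->
  (on_qubit k s *m on_qubit l t) i j =
  if [forall m : 'I_K, (m != k) && (m != l) ==> (qbit i m == qbit j m)]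
  then s (inord (qbit i k)) (inord (qbit j k)) * t (inord (qbit i l)) (inord (qbit j l))
  else 0.
Proof.
(* The second factor leaves qubit [k] alone, so the only intermediate index that contributes has bit
   [k] equal to that of [j]. *)
move=> kl; rewrite on_qubit_mulmxE (bigD1 (qbit j k)) //= big1 ?addr0; last first.
  move=> b bj; rewrite on_qubitE; case: ifP; last by rewrite mulr0.
  move=> /forallP/(_ k); rewrite kl qbit_setbit eqxx /= => /eqP eb.
  by rewrite eb eqxx in bj.
rewrite on_qubitE qbit_setbit eq_sym (negPf kl).
suff -> : eq_off l (setbit i k (qbit j k)) j =
  [forall m : 'I_K, (m != k) && (m != l) ==> (qbit i m == qbit j m)].
  by case: ifP; rewrite ?mulr0.
apply: eq_forallb => m; rewrite qbit_setbit.
by case: (eqVneq m k) => [->|//]; rewrite eqxx implybT.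
Qed.

Lemma on_qubitC (K : nat) (k l : 'I_K) (s t : 'M[C]_2) : k != l ->
  on_qubit k s *m on_qubit l t = on_qubit l t *m on_qubit k s.
Proof.
move=> kl; apply/matrixP => i j; rewrite !on_qubitMM // 1?eq_sym //.
by under eq_forallb do rewrite andbC; case: ifP; rewrite // mulrC.
Qed.

(** Operators on distinct qubits commute, so only the diagonal terms of the double sum survive;
    [1/4] is the product of the two factors [1/2]. *)
Lemma comm_Stot (K : nat) (a b : 'I_3) :
  Stot R K a *m Stot R K b - Stot R K b *m Stot R K a =
  \sum_(k < K) (4%:R^-1) *: on_qubit k (pauli R a *m pauli R b - pauli R b *m pauli R a).
Proof.
rewrite /Stot mulmx_suml [X in _ - X]mulmx_sumr -sumrB; apply: eq_bigr => k _.
rewrite mulmx_sumr [X in _ - X]mulmx_suml -sumrB (bigD1 k) //= big1 ?addr0; last first.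
  by move=> l lk; rewrite -!scalemxAl -!scalemxAr on_qubitC 1?eq_sym // subrr.
rewrite -!scalemxAl -!scalemxAr !on_qubitM !scalerA -scalerBr -linearB.
by congr (_ *: _); rewrite -invfM -natrM.
Qed.
End Qubits.

(** * Angular momentum algebra *)

Section AngularMomentum.
Variable R : realType.
Local Notation C := R[i].

Lemma mxadjE m n (A : 'M[C]_(m, n)) i j : mxadj A i j = (A j i)^*.
Proof. by rewrite !mxE. Qed.

Lemma mxadjM m n p (A : 'M[C]_(m, n)) (B : 'M[C]_(n, p)) :
  mxadj (A *m B) = mxadj B *m mxadj A.
Proof. by rewrite /mxadj map_mxM trmx_mul. Qed.

Lemma mxadjB m n (A B : 'M[C]_(m, n)) : mxadj (A - B) = mxadj A - mxadj B.
Proof. by apply/matrixP => i j; rewrite !mxE rmorphB. Qed.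

Lemma mxadjZ m n a (A : 'M[C]_(m, n)) : mxadj (a *: A) = a^* *: mxadj A.
Proof. by apply/matrixP => i j; rewrite !mxE rmorphM. Qed.

Lemma mxadj1 n : mxadj 1%:M = 1%:M :> 'M[C]_n.
Proof. by apply/matrixP => i j; rewrite !mxE conjC_nat eq_sym. Qed.

Lemma mxadj_sum m n (I : finType) (F : I -> 'M[C]_(m, n)) :
  mxadj (\sum_i F i) = \sum_i mxadj (F i).
Proof.
apply/matrixP => i j; rewrite mxadjE !summxE rmorph_sum.
by apply: eq_bigr => k _; rewrite mxadjE.
Qed.

Lemma on_qubit_adj (K : nat) (k : 'I_K) (s : 'M[C]_2) :
  mxadj (on_qubit k s) = on_qubit k (mxadj s).
Proof.
apply/matrixP => i j; rewrite mxadjE !on_qubitE mxadjE.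
by rewrite eq_off_sym; case: ifP => // _; rewrite conjC0.
Qed.

Lemma pauli_adj (a : 'I_3) : mxadj (pauli R a) = pauli R a.
Proof.
apply/matrixP => i j; rewrite !mxE.
by case: a => -[|[|[|//]]] ?; case: i => -[|[|//]] ?; case: j => -[|[|//]] ? /=;
  rewrite /eq_op/= ?rmorph0 ?rmorph1 ?rmorphN1 //; apply/eqP; rewrite eq_complex /= ?oppr0 ?opprK !eqxx.
Qed.

Lemma Stot_adj (K : nat) (a : 'I_3) : mxadj (Stot R K a) = Stot R K a.
Proof.
rewrite /Stot mxadj_sum; apply: eq_bigr => k _.
by rewrite mxadjZ on_qubit_adj pauli_adj fmorphV rmorph_nat.
Qed.

(** The congruences say that [(a, b, c)] is a cyclic rotation of the three axes, so that one
    statement covers all three relations. *)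
Lemma comm_pauli (a b c : 'I_3) : (val b = val a + 1 %[mod 3])%N ->
  (val c = val a + 2 %[mod 3])%N ->
  pauli R a *m pauli R b - pauli R b *m pauli R a = (2%:R * 'i%C) *: pauli R c.
Proof.
case: a => -[|[|[|//]]] ?; case: b => -[|[|[|//]]] ? //; case: c => -[|[|[|//]]] ? // _ _.
all: apply/matrixP => i j; rewrite !mxE !big_ord_recl !big_ord0 !mxE /=.
all: case: i => -[|[|//]] ?; case: j => -[|[|//]] ?.
all: rewrite /eq_op /=; apply/eqP; rewrite eq_complex /=.
all: by apply/andP; split; apply/eqP; ring.
Qed.

Lemma comm_Stot_cyclic (K : nat) (a b c : 'I_3) : (val b = val a + 1 %[mod 3])%N ->
  (val c = val a + 2 %[mod 3])%N ->
  Stot R K a *m Stot R K b = Stot R K b *m Stot R K a + 'i%C *: Stot R K c.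
Proof.
move=> ab ac; apply/eqP; rewrite addrC -subr_eq; apply/eqP.
rewrite comm_Stot (comm_pauli ab ac) /Stot scaler_sumr; apply: eq_bigr => k _.
rewrite linearZ !scalerA; congr (_ *: _).
rewrite mulrA [RHS]mulrC; congr (_ * _).
have e4 : 4%:R = 2%:R * 2%:R :> C by rewrite -natrM.
by rewrite e4 invfM mulfVK // pnatr_eq0.
Qed.

(** The commutators of [X^2] and [Y^2] with [Z] are [- a (XY + YX)] and [a (XY + YX)], which
    cancel. *)
Lemma comm_sumsq n (X Y Z : 'M[C]_n) (a : C) :
  X *m Z = Z *m X - a *: Y -> Y *m Z = Z *m Y + a *: X ->
  (X *m X + Y *m Y) *m Z = Z *m (X *m X + Y *m Y).
Proof.
move=> XZ YZ; rewrite mulmxDl mulmxDr -!mulmxA XZ YZ mulmxBr mulmxDr !mulmxA XZ YZ.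
rewrite mulmxBl mulmxDl -!scalemxAl -!scalemxAr -!mulmxA.
rewrite -[X in X + _]addrA -[X in _ + X]addrA addrACA -[RHS]addr0; congr (_ + _).
by rewrite [X in _ + X]addrC -opprD addNr.
Qed.

(** Only the first generator is treated: the hypotheses are invariant under cyclic rotation, which
    yields the other two in [S2_comm]. *)
Lemma casimir_comm n (X Y Z : 'M[C]_n) (a : C) :
  X *m Y = Y *m X + a *: Z -> Y *m Z = Z *m Y + a *: X -> Z *m X = X *m Z + a *: Y ->
  (X *m X + (Y *m Y + Z *m Z)) *m X = X *m (X *m X + (Y *m Y + Z *m Z)).
Proof.
move=> XY YZ ZX; rewrite mulmxDl mulmxDr mulmxA; congr (_ + _).
by apply: (@comm_sumsq _ _ _ _ a) => //; rewrite XY addrK.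
Qed.

(** The axes are written with [lift] to coincide with the indices that [big_ord_recl] produces. *)
Definition ax : 'I_3 := ord0.
Definition ay : 'I_3 := lift ord0 ord0.
Definition az : 'I_3 := lift ord0 (lift ord0 ord0).

Lemma sum_axes (V : nmodType) (F : 'I_3 -> V) : \sum_(a < 3) F a = F ax + (F ay + F az).
Proof. by rewrite !big_ord_recl big_ord0 addr0. Qed.

Lemma S2E (K : nat) : S2 R K = Stot R K ax *m Stot R K ax +
  (Stot R K ay *m Stot R K ay + Stot R K az *m Stot R K az).
Proof. exact: (sum_axes (fun a => Stot R K a *m Stot R K a)). Qed.

Lemma S2_comm (K : nat) (a : 'I_3) : S2 R K *m Stot R K a = Stot R K a *m S2 R K.
Proof.
have XY := @comm_Stot_cyclic K ax ay az erefl erefl.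
have YZ := @comm_Stot_cyclic K ay az ax erefl erefl.
have ZX := @comm_Stot_cyclic K az ax ay erefl erefl.
rewrite S2E; move: XY YZ ZX.
have : [\/ a = ax, a = ay | a = az].
  by case: a => -[|[|[|//]]] ?; [apply: Or31|apply: Or32|apply: Or33]; exact: val_inj.
move: (Stot R K) => S; case=> ->; move: (S ax) (S ay) (S az) => X Y Z XY YZ ZX.
- exact: casimir_comm XY YZ ZX.
- by rewrite addrC -addrA; exact: casimir_comm YZ ZX XY.
- by rewrite addrA addrC; exact: casimir_comm ZX XY YZ.
Qed.

End AngularMomentum.

(** * Weights of the computational basis *)

(** Compare power series: odd terms cancel on the left, and even ones are dominated because
    [2^n n! <= (2n)!]. *)
Lemma cosh_le (R : realType) (t : R) : expR t + expR (- t) <= 2 * expR (t ^+ 2 / 2).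
Proof.
have cvgS (x : R) : series (exp_coeff x) n @[n --> \oo] --> expR x.
  exact: is_cvg_series_exp_coeff.
(* Partial sums of even length pair each even term with the following odd one. *)
have cvgL : series (exp_coeff t) n.*2 + series (exp_coeff (- t)) n.*2 @[n --> \oo]
    --> expR t + expR (- t).
  have c2 : n.*2 @[n --> \oo] --> \oo.
    by apply/cvgnyPge => m; exists m => // n /= mn; rewrite -addnn (leq_trans mn) // leq_addr.
  by apply: cvgD; apply: (cvg_comp (fun n => n.*2) _ c2 (cvgS _)).
have cvgR : 2 * series (exp_coeff (t ^+ 2 / 2)) n @[n --> \oo] --> 2 * expR (t ^+ 2 / 2).
  by apply: cvgMr; exact: cvgS.
rewrite -(cvg_lim _ cvgL) // -(cvg_lim _ cvgR) //.
apply: ler_lim; [exact: cvgP cvgL|exact: cvgP cvgR|].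
apply: nearW => n; rewrite /series /=; elim: n => [|n IH].
  by rewrite !big_geq // mulr0 addr0.
rewrite doubleS !big_nat_recr //= mulrDr.
set a := \sum_(0 <= i < _) _ in IH *; set b := \sum_(0 <= i < _) _ in IH *.
have -> : exp_coeff (- t) n.*2 = exp_coeff t n.*2.
  by rewrite /exp_coeff /= -mul2n !exprM sqrrN.
have -> : exp_coeff (- t) n.*2.+1 = - exp_coeff t n.*2.+1.
  by rewrite /exp_coeff /= exprNn -signr_odd /= odd_double expr1 mulN1r mulNr.
suff : exp_coeff t n.*2 <= exp_coeff (t ^+ 2 / 2) n by lra.
rewrite /exp_coeff /= expr_div_n -exprM mul2n -mulrA ler_wpM2l //.
  by rewrite -mul2n exprM exprn_ge0 // sqr_ge0.
rewrite -invfM lef_pV2 ?posrE ?mulr_gt0 ?ltr0n ?fact_gt0 ?exprn_gt0 //.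
rewrite -natrX -natrM ler_nat.
elim: n {IH a b} => // n IH; rewrite doubleS !factS expnS.
apply: (@leq_trans (2 * n.+1 * (2 ^ n * n`!))); first by rewrite mulnACA.
rewrite [leqRHS]mulnA; apply: leq_mul => //.
by rewrite -doubleS mul2n leq_pmulr.
Qed.

Section Weights.
Variable R : realType.
Local Notation C := R[i].

(** A set bit is a spin down, so the basis vector [i] has [S_z]-eigenvalue [K/2 - wt i]. *)
Definition wt (K : nat) (i : 'I_(2 ^ K)) : nat := \sum_(k < K) qbit i k.

Lemma wt_le (K : nat) (i : 'I_(2 ^ K)) : (wt i <= K)%N.
Proof.
rewrite -[leqRHS](card_ord K) -sum1_card; apply: leq_sum => k _.
exact: leq_b1.
Qed.

(** The exponential factors over the qubits, a bit contributing [exp t] or [exp (- t)], and the sum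
    over bit strings distributes into a product. *)
Lemma sum_expR_wt (K : nat) (t : R) :
  \sum_(i < 2 ^ K) expR (t * (K%:R - 2 * (wt i)%:R)) = (expR t + expR (- t)) ^+ K.
Proof.
pose G (b : bool) := expR (if b then - t else t).
have -> : expR t + expR (- t) = \sum_(b : bool) G b by rewrite big_bool /= addrC.
rewrite -[in RHS](card_ord K) -prodr_const bigA_distr_bigA /=.
have [g bK gK] := bits_bij K.
rewrite [RHS](reindex (@bits K)) /=; last by exists g => x _; [exact: bK|exact: gK].
apply: eq_bigr => i _; rewrite -expR_sum; congr expR.
transitivity (\sum_(k < K) (t - 2 * t * (qbit i k)%:R)).
  rewrite sumrB sumr_const card_ord -mulr_sumr /wt natr_sum.
  by rewrite mulrBr mulr_natr mulrCA !mulrA.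
by apply: eq_bigr => k _; rewrite ffunE; case: qbit; rewrite /=; ring.
Qed.

(** Chernoff's argument: keep only the terms of weight [w] in the exponential sum and bound the
    whole sum by [cosh_le]. The sign of [K/2 - w] is arbitrary, so both tails are covered. *)
Lemma card_wt_le (K w : nat) : (0 < K)%N ->
  #|[pred i : 'I_(2 ^ K) | wt i == w]|%:R
    <= (2 ^ K)%:R * expR (- (2 * (K%:R / 2 - w%:R) ^+ 2) / K%:R) :> R.
Proof.
move=> K0; have K0' : K%:R != 0 :> R by rewrite pnatr_eq0 -lt0n.
(* This [t] minimizes the exponent [K t^2 / 2 - 2 t d], with minimum [- 2 d^2 / K]. *)
set d : R := K%:R / 2 - w%:R; pose t := 2 * d / K%:R.
have le1 : #|[pred i : 'I_(2 ^ K) | wt i == w]|%:R * expR (t * (K%:R - 2 * w%:R))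
    <= (2 * expR (t ^+ 2 / 2)) ^+ K.
  apply: le_trans (lerXn2r K _ _ (cosh_le t)); rewrite ?nnegrE ?addr_ge0 ?mulr_ge0 ?expR_ge0 //.
  rewrite -sum_expR_wt mulr_natl -sumr_const.
  rewrite [leRHS](bigID (fun i => wt i == w)) /= -[leLHS]addr0 lerD //.
    by rewrite le_eqVlt; apply/orP; left; apply/eqP; apply: eq_big => // i /eqP ->.
  by apply: sumr_ge0 => i _; exact: expR_ge0.
rewrite -(ler_pM2r (expR_gt0 (t * (K%:R - 2 * w%:R)))) (le_trans le1) //.
rewrite exprMn -natrX -expRM_natl -[leRHS]mulrA -expRD ler_wpM2l // ler_expR.
by rewrite le_eqVlt; apply/orP; left; apply/eqP; rewrite /t /d; field.
Qed.

End Weights.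

(** * Raising operator *)

Section Ladder.
Variable R : realType.
Local Notation C := R[i].

(** The orthogonal projector onto the [S_z]-eigenspace of eigenvalue [K/2 - w]. *)
Definition Dwt (K w : nat) : 'M[C]_(2 ^ K) := diag_mx (\row_i (wt i == w)%:R).

Definition Splus (K : nat) : 'M[C]_(2 ^ K) := Stot R K ax + 'i%C *: Stot R K ay.
Definition Sminus (K : nat) : 'M[C]_(2 ^ K) := Stot R K ax - 'i%C *: Stot R K ay.

Lemma S2_ladder (K : nat) :
  S2 R K = Sminus K *m Splus K + Stot R K az *m Stot R K az + Stot R K az.
Proof.
have := @comm_Stot_cyclic R K ax ay az erefl erefl.
rewrite S2E /Sminus /Splus.
move: (Stot R K ax) (Stot R K ay) (Stot R K az) => X Y Z XY.
rewrite mulmxBl !mulmxDr -!scalemxAl -!scalemxAr XY scalerA.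
have -> : 'i%C * 'i%C = -1 :> C by rewrite -expr2 sqr_i.
rewrite scaleN1r scalerDr scalerA.
have -> : 'i%C * 'i%C = -1 :> C by rewrite -expr2 sqr_i.
rewrite scaleN1r; move: (X *m X) (Y *m Y) (Z *m Z) ('i%C *: (Y *m X)) => a b c d.
by apply/matrixP => i j; rewrite !mxE; ring.
Qed.

Lemma Sz_Splus (K : nat) :
  Stot R K az *m Splus K = Splus K *m Stot R K az + Splus K.
Proof.
have YZ := @comm_Stot_cyclic R K ay az ax erefl erefl.
have ZX := @comm_Stot_cyclic R K az ax ay erefl erefl.
rewrite /Splus; move: YZ ZX.
move: (Stot R K ax) (Stot R K ay) (Stot R K az) => X Y Z YZ ZX.
rewrite mulmxDr mulmxDl -!scalemxAl -!scalemxAr ZX YZ scalerDr scalerA.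
have -> : 'i%C * 'i%C = -1 :> C by rewrite -expr2 sqr_i.
rewrite scaleN1r; move: (X *m Z) (Z *m Y) => a b.
by apply/matrixP => i j; rewrite !mxE; ring.
Qed.

Lemma Stot_az (K : nat) :
  Stot R K az = diag_mx (\row_i (K%:R / 2 - (wt i)%:R)).
Proof.
apply/matrixP => i j; rewrite [RHS]mxE mxE /Stot summxE.
have paulizE (b c : bool) :
    pauli R az (inord b) (inord c) = if b == c then (if b then -1 else 1) else 0.
  rewrite mxE /= -val_eqE /= !inordK ?ltnS ?leq_b1 //.
  by case: b; case: c.
case: eqVneq => [<-|ij].
  rewrite mulr1n (eq_bigr (fun k : 'I_K => 2^-1 - (qbit i k)%:R)).
    by rewrite sumrB sumr_const card_ord -natr_sum mulr_natl.
  move=> k _; rewrite mxE on_qubitE paulizE eqxx.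
  have -> : eq_off k i i by apply/forallP => m; rewrite eqxx implybT.
  case: qbit; last by rewrite mulr1 subr0.
  by rewrite /=; field.
rewrite mulr0n big1 // => k _; rewrite mxE on_qubitE paulizE.
(* A nonzero entry needs agreement off qubit [k], and also at [k] since [sigma_z] is diagonal; this
   would force [i = j]. *)
case: ifP => eqij; last by rewrite mulr0.
case: eqP => eqk; last by rewrite mulr0.
case/eqP: ij; apply: bits_inj; apply/ffunP => m; rewrite !ffunE.
by case: (eqVneq m k) => [->//|mk]; have /forallP/(_ m) := eqij; rewrite mk => /eqP.
Qed.

(** Comparing entries of the commutation with the diagonal [S_z] shows that [A i j] vanishes when
    the weights of [i] and [j] differ. *)
Lemma comm_Dwt (K w : nat) (A : 'M[C]_(2 ^ K)) :
  A *m Stot R K az = Stot R K az *m A -> A *m Dwt K w = Dwt K w *m A.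
Proof.
move=> /matrixP AZ; apply/matrixP => i j.
rewrite /Dwt mul_mx_diag mul_diag_mx !mxE.
have := AZ i j; rewrite Stot_az mul_mx_diag mul_diag_mx !mxE.
have [->|ij] := eqVneq (wt i) (wt j); first by move=> _; rewrite mulrC.
move=> eqz; have : A i j * ((wt i)%:R - (wt j)%:R) = 0.
  by rewrite -[RHS](subrr (A i j * (K%:R / 2 - (wt j)%:R))) [in X in _ = _ - X]eqz; ring.
move/eqP; rewrite mulf_eq0 subr_eq0 eqr_nat (negPf ij) orbF => /eqP ->.
by rewrite mulr0 mul0r.
Qed.

(** Raising [S_z] by one removes one set bit: by [Sz_Splus], an entry [(i, j)] is nonzero only if
    [wt j = wt i + 1]. Weight 0 is the top of the ladder and is killed. *)
Lemma Splus_Dwt (K w : nat) :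
  Splus K *m Dwt K w = if w is w'.+1 then Dwt K w' *m Splus K else 0.
Proof.
have ZS i j : (Stot R K az *m Splus K) i j = (Splus K *m Stot R K az) i j + Splus K i j.
  by rewrite Sz_Splus [LHS]mxE.
move: (Splus K) ZS => S ZS.
have Sij i j : S i j != 0 -> wt j = (wt i).+1.
  move=> nz; have := ZS i j; rewrite Stot_az mul_mx_diag mul_diag_mx !mxE => eqz.
  have : S i j * ((wt j)%:R - (wt i).+1%:R) = 0.
    rewrite -[X in _ = X](subrr ((K%:R / 2 - (wt i)%:R) * S i j)).
    by rewrite [in X in _ = _ - X]eqz -natr1; ring.
  by move/eqP; rewrite mulf_eq0 (negPf nz) /= subr_eq0 eqr_nat => /eqP.
apply/matrixP => i j; rewrite mul_mx_diag mxE [in LHS]mxE.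
have [S0|/Sij ->] := eqVneq (S i j) 0.
  rewrite S0 mul0r; case: w => [|w]; first by rewrite mxE.
  by rewrite mul_diag_mx mxE S0 mulr0.
case: w => [|w]; first by rewrite mulr0 mxE.
by rewrite mul_diag_mx mxE [in RHS]mxE eqSS mulrC.
Qed.

Lemma Sz_Dwt (K w : nat) :
  Stot R K az *m Dwt K w = (K%:R / 2 - w%:R) *: Dwt K w.
Proof.
apply/matrixP => i j; rewrite Stot_az mul_diag_mx !mxE.
by case: (eqVneq (wt i) w) => [->//|_]; rewrite mul0rn !mulr0.
Qed.

Lemma Dwt_idem (K w : nat) : Dwt K w *m Dwt K w = Dwt K w.
Proof.
apply/matrixP => i j; rewrite mul_diag_mx !mxE.
by case: (wt i == w); rewrite ?mul1r // mul0r mul0rn.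
Qed.

Lemma sum_Dwt (K : nat) : \sum_(w < K.+1) Dwt K w = 1%:M.
Proof.
apply/matrixP => i j; rewrite summxE !mxE.
under eq_bigr do rewrite !mxE.
rewrite sumrMnl; congr (_ *+ _).
have lt := wt_le i; rewrite -ltnS in lt.
rewrite (bigD1 (Ordinal lt)) //= eqxx big1 ?addr0 // => w.
by rewrite -val_eqE /= eq_sym => /negPf ->.
Qed.

(** In a full-rank factorization [A = C R], idempotence and one-sided inverses of [C] and [R] give
    [R C = 1], whose trace is the rank. *)
Lemma mxtrace_idem (F : fieldType) n (A : 'M[F]_n) :
  A *m A = A -> \tr A = (\rank A)%:R.
Proof.
move=> AA; rewrite -{1}[A]mulmx_base mxtrace_mulC.
suff -> : row_base A *m col_base A = 1%:M by rewrite mxtrace1.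
have := AA; rewrite -{1 2 3}[A]mulmx_base => eqA.
have /row_fullP[L LA] := col_base_full A; have /row_freeP[Q' AQ] := row_base_free A.
move: (col_base A) (row_base A) eqA LA AQ => cb rb eqA LA AQ.
have := congr1 (fun X => L *m X *m Q') eqA.
by rewrite /= !mulmxA LA mul1mx -!mulmxA AQ mulmx1.
Qed.

(** Left multiplication by [X] is injective on the column space of [A]. Ranks being compared through
    row spaces, the proof shows that [A] kills every column of the cokernel of [X *m A]. *)
Lemma mxrank_mulmx_inj (F : fieldType) m n p (A : 'M[F]_(m, n)) (X : 'M[F]_(p, m)) :
  (forall v : 'cV_n, X *m (A *m v) = 0 -> A *m v = 0) -> (\rank A <= \rank (X *m A))%N.
Proof.
move=> injX; apply: mxrankS; rewrite submxE; apply/eqP/matrixP => i j.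
move: (cokermx _) (mulmx_coker (X *m A)) => B /(congr1 (mulmx^~ (delta_mx j 0 : 'cV_n))).
rewrite mul0mx -!mulmxA => /injX /matrixP/(_ i 0).
by rewrite mulmxA -colE [LHS]mxE => ->; rewrite !mxE.
Qed.

Lemma rank_Dwt (K w : nat) : \rank (Dwt K w) = #|[pred i : 'I_(2 ^ K) | wt i == w]|.
Proof.
apply/eqP; rewrite -(eqr_nat C) -mxtrace_idem ?Dwt_idem //.
apply/eqP; rewrite mxtrace_diag -sum1_card natr_sum.
by rewrite [RHS]big_mkcond; apply: eq_bigr => i _; rewrite mxE inE; case: eqP.
Qed.

End Ladder.

(** * Trace of the complementary projector *)

Section Projector.
Variable R : realType.
Local Notation C := R[i].

Lemma mulmx_ext m n (A B : 'M[C]_(m, n)) : (forall v : 'cV_n, A *m v = B *m v) -> A = B.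
Proof.
move=> eqAB; apply/matrixP => i j.
have /matrixP/(_ i 0) := eqAB (delta_mx j 0).
by rewrite -!colE !mxE.
Qed.

(** Invariance of [W] means [P X P = X P]; taking adjoints gives [P X P = P X]. *)
Lemma orth_proj_comm n (P X : 'M[C]_n) (W : 'cV[C]_n -> Prop) :
  orth_proj P W -> (forall v, W v -> W (X *m v)) -> mxadj X = X -> P *m X = X *m P.
Proof.
move=> [Padj PP WP] WX Xadj.
have PXP : P *m (X *m P) = X *m P.
  apply: mulmx_ext => v; rewrite -!mulmxA; apply/WP/WX/WP.
  by rewrite mulmxA PP.
have := congr1 (@mxadj R _ _) PXP.
by rewrite !mxadjM Padj Xadj -mulmxA PXP => <-.
Qed.

Lemma comp_proj_adj n (P : 'M[C]_n) (W : 'cV[C]_n -> Prop) :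
  orth_proj P W -> mxadj (1%:M - P) = 1%:M - P.
Proof. by move=> [PA _ _]; rewrite mxadjB mxadj1 PA. Qed.

Lemma comp_proj_idem n (P : 'M[C]_n) (W : 'cV[C]_n -> Prop) :
  orth_proj P W -> (1%:M - P) *m (1%:M - P) = 1%:M - P.
Proof. by move=> [_ PP _]; rewrite mulmxBl mul1mx mulmxBr mulmx1 PP subrr subr0. Qed.

Lemma in_HJ_stable K (J : R) (X : 'M[C]_(2 ^ K)) (v : 'cV[C]_(2 ^ K)) :
  S2 R K *m X = X *m S2 R K -> in_HJ J v -> in_HJ J (X *m v).
Proof.
move=> SX [vs [-> eig]]; exists (fun j => X *m vs j); split.
  by rewrite mulmx_sumr.
by move=> j jJ; rewrite mulmxA SX -mulmxA eig // -scalemxAr.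
Qed.

Lemma in_HJ_eigen K (J : R) (v : 'cV[C]_(2 ^ K)) (j : nat) :
  (j <= K./2)%N -> j%:R <= J -> S2 R K *m v = (j * j.+1)%:R *: v -> in_HJ J v.
Proof.
rewrite -ltnS => jK jJ eig.
exists (fun i => if i == Ordinal jK then v else 0); split.
  by rewrite (bigD1 (Ordinal jK)) //= eqxx big1 ?addr0 // => i /andP[_ /negPf ->].
move=> i _; case: eqVneq => [->|_]; first exact: eig.
by rewrite mulmx0 scaler0.
Qed.

Variables (K : nat) (J : R) (P : 'M[C]_(2 ^ K)).
Hypothesis (PHJ : orth_proj P (in_HJ J)).
Local Notation Q := (1%:M - P).

Lemma comp_proj_Stot (a : 'I_3) : Q *m Stot R K a = Stot R K a *m Q.
Proof.
rewrite mulmxBl mulmxBr mul1mx mulmx1; congr (_ - _).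
apply: (orth_proj_comm PHJ) => [v|]; last exact: Stot_adj.
exact/in_HJ_stable/S2_comm.
Qed.

Lemma comp_proj_Splus : Q *m Splus R K = Splus R K *m Q.
Proof.
rewrite /Splus; move: Q (comp_proj_Stot ax) (comp_proj_Stot ay) => Q' cX cY.
by rewrite mulmxDr mulmxDl -scalemxAr -scalemxAl cX cY.
Qed.

(** A vector in the range of [Q] that also lies in the range of [P] satisfies [Q v = P Q v = 0]. *)
Lemma comp_proj_eq0 (v : 'cV[C]_(2 ^ K)) : in_HJ J (Q *m v) -> Q *m v = 0.
Proof.
have [_ PP WP] := PHJ; move=> /WP; rewrite mulmxA mulmxBr mulmx1 PP subrr mul0mx.
by move=> <-.
Qed.

(* On the weight space [w] the kernel of the raising operator lies in a single eigenspace
   of [S2], with [j = |m|] or [j = |m| - 1] according to the sign of [m = K/2 - w]. *)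
Lemma rank_weight_step (w : nat) : ~~ odd K -> (w <= K)%N ->
  (if (w <= K./2)%N then K./2 - w else w - (K./2).+1)%N%:R <= J ->
  (\rank (Q *m Dwt R K w) <= if w is w'.+1 then \rank (Q *m Dwt R K w') else 0)%N.
Proof.
move=> Ke wK; set j := (X in X%:R <= J) => jJ.
pose m : C := K%:R / 2 - w%:R.
have KE : K%:R / 2 = (K./2)%:R :> C.
  by rewrite -[in LHS](even_halfK Ke) -muln2 natrM mulfK // pnatr_eq0.
(* Here [m = j] in the first case and [m = - j - 1] in the second. *)
have mj : m ^+ 2 + m = (j * j.+1)%:R.
  rewrite /m KE /j natrM -natr1; case: (leqP w K./2) => wh.
    by rewrite natrB //; ring.
  by rewrite natrB // -natr1; ring.
have jK : (j <= K./2)%N.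
  rewrite /j; case: (leqP w K./2) => wh; first exact: leq_subr.
  rewrite leq_subLR (leq_trans wK) // -[leqLHS](even_halfK Ke) -addnn addSn.
  exact: leqnSn.
(* A vector of this range killed by [S_+] is an [S2]-eigenvector for [j (j + 1)] by [S2_ladder],
   hence lies in [in_HJ J] and vanishes. *)
have inj : (\rank (Q *m Dwt R K w) <= \rank (Splus R K *m (Q *m Dwt R K w)))%N.
  apply: mxrank_mulmx_inj => v SN0.
  have ZN : Stot R K az *m (Q *m Dwt R K w *m v) = m *: (Q *m Dwt R K w *m v).
    by rewrite !mulmxA -comp_proj_Stot -(mulmxA Q) Sz_Dwt -!mulmxA -scalemxAl -scalemxAr.
  rewrite -mulmxA; apply: comp_proj_eq0; apply: (in_HJ_eigen jK jJ).
  rewrite (mulmxA Q); move: (Q *m Dwt R K w *m v) ZN SN0 => N ZN SN0.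
  rewrite S2_ladder 2!mulmxDl -!(mulmxA _ _ N) SN0 mulmx0 add0r.
  by rewrite !ZN -scalemxAr ZN scalerA -expr2 -scalerDl mj.
(* Moving [S_+] to the right past [Q] and the weight projector lowers [w] by one and leaves a right
   factor that cannot increase the rank. *)
apply: leq_trans inj _; rewrite mulmxA -comp_proj_Splus -mulmxA Splus_Dwt.
case: w {wK j jJ m mj jK} => [|w]; first by rewrite mulmx0 mxrank0.
by rewrite mulmxA mxrankM_maxl.
Qed.

(** Each [Q *m Dwt R K w] is a product of commuting idempotents, so its trace is its rank. *)
Lemma mxtrace_comp_proj : \tr Q = (\sum_(w < K.+1) \rank (Q *m Dwt R K w))%N%:R.
Proof.
rewrite -[Q in LHS]mulmx1 -[X in _ *m X]sum_Dwt mulmx_sumr raddf_sum natr_sum; apply: eq_bigr => w _.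
have QD := comm_Dwt w (comp_proj_Stot az).
by rewrite -mxtrace_idem // mulmxA -(mulmxA Q) -QD mulmxA (comp_proj_idem PHJ) -mulmxA Dwt_idem.
Qed.

Lemma rank_weight_lt_large_spin (w : nat) : (0 < K)%N -> ~~ odd K -> 0 <= J -> (w <= K)%N ->
  J < (if (w <= K./2)%N then K./2 - w else w - (K./2).+1)%N%:R ->
  (\rank (Q *m Dwt R K w))%:R < (2 ^ K)%:R * expR (- (2 * J ^+ 2) / K%:R).
Proof.
move=> K0 Ke J0 wK Jj.
have KE : K%:R / 2 = (K./2)%:R :> R.
  by rewrite -[in LHS](even_halfK Ke) -muln2 natrM mulfK // pnatr_eq0.
apply: (@le_lt_trans _ _ #|[pred i : 'I_(2 ^ K) | wt i == w]|%:R).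
  by rewrite ler_nat -(rank_Dwt R) mxrankM_maxr.
apply: le_lt_trans (card_wt_le R w K0) _.
rewrite ltr_pM2l ?ltr0n ?expn_gt0 // ltr_expR !mulNr ltrN2.
rewrite ltr_pM2r ?invr_gt0 ?ltr0n // ltr_pM2l // KE.
(* The spin is [|m|] or [|m| - 1] with [m = K/2 - w], so it never exceeds [|m|]. *)
suff : J < `|(K./2)%:R - w%:R|.
  by move=> Jd; rewrite -[ltRHS]real_normK ?num_real // ltrXn2r.
move: Jj; case: (leqP w K./2) => wh.
  by rewrite natrB // => Jj; rewrite ger0_norm // subr_ge0 ler_nat.
rewrite natrB // -natr1 => Jj; rewrite distrC ger0_norm ?subr_ge0 ?ler_nat ?(ltnW wh) //.
lra.
Qed.

(** Induction down the ladder: if the spin attached to [w] is at most [J], the rank is bounded by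
    that of the previous weight, or is 0 at the top; otherwise the Chernoff count applies
    directly. *)
Lemma rank_weight_lt (w : nat) : (0 < K)%N -> ~~ odd K -> 0 <= J -> (w <= K)%N ->
  (\rank (Q *m Dwt R K w))%:R < (2 ^ K)%:R * expR (- (2 * J ^+ 2) / K%:R).
Proof.
move=> K0 Ke J0.
elim: w => [|w IH] wK; set w1 := (w1 in Dwt _ _ w1) in wK *;
  have [jJ|Jj] := leP ((if (w1 <= K./2)%N then K./2 - w1 else w1 - (K./2).+1)%N%:R) J.
- have := rank_weight_step Ke wK jJ; rewrite leqn0 => /eqP ->.
  by rewrite mulr_gt0 ?expR_gt0 // ltr0n expn_gt0.
- exact: rank_weight_lt_large_spin.
- apply: le_lt_trans (IH (ltnW wK)); rewrite ler_nat.
  exact: rank_weight_step Ke wK jJ.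
- exact: rank_weight_lt_large_spin.
Qed.

Lemma mxtrace_comp_proj_lt : (0 < K)%N -> ~~ odd K -> 0 <= J ->
  complex.Re (\tr Q) / (2 ^ K)%:R < K.+1%:R * expR (- (2 * J ^+ 2) / K%:R).
Proof.
move=> K0 Ke J0; have e0 : 0 < (2 ^ K)%:R :> R by rewrite ltr0n expn_gt0.
rewrite ltr_pdivrMr // mxtrace_comp_proj.
have -> (n : nat) : complex.Re (n%:R : C) = n%:R by rewrite -(rmorph_nat (real_complex R)).
set B := expR _.
have -> : K.+1%:R * B * (2 ^ K)%:R = \sum_(w < K.+1) (2 ^ K)%:R * B.
  by rewrite sumr_const card_ord -[RHS]mulr_natl mulrAC mulrA.
rewrite natr_sum.
apply: ltr_sum; first by apply/hasP; exists ord0; rewrite // mem_index_enum.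
by move=> w _; apply: rank_weight_lt => //; rewrite -ltnS.
Qed.

End Projector.

(** * Uniform pure states *)

Section ComplexMeasurable.
Context d (T : measurableType d) (R : realType).
Local Notation C := R[i].
Implicit Types f g : T -> C.

(** Real and imaginary parts are treated separately, matching the generators in [coord_gen]. *)
Definition cmeasurable f :=
  measurable_fun setT (fun x => complex.Re (f x)) /\
  measurable_fun setT (fun x => complex.Im (f x)).

Lemma cmeasurable_cst (c : C) : cmeasurable (fun _ => c).
Proof. by split; exact: measurable_cst. Qed.

Lemma cmeasurableD f g : cmeasurable f -> cmeasurable g -> cmeasurable (fun x => f x + g x).
Proof.
move=> [rf imf] [rg img]; split.
- rewrite (_ : (fun x => _) = (fun x => complex.Re (f x) + complex.Re (g x))).
    exact: measurable_funD.
  by apply/funext => x; case: (f x); case: (g x).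
- rewrite (_ : (fun x => _) = (fun x => complex.Im (f x) + complex.Im (g x))).
    exact: measurable_funD.
  by apply/funext => x; case: (f x); case: (g x).
Qed.

Lemma cmeasurableM f g : cmeasurable f -> cmeasurable g -> cmeasurable (fun x => f x * g x).
Proof.
move=> [rf imf] [rg img]; split.
- rewrite (_ : (fun x => _) =
    (fun x => complex.Re (f x) * complex.Re (g x) - complex.Im (f x) * complex.Im (g x))).
    by apply: measurable_funB; exact: measurable_funM.
  by apply/funext => x; case: (f x); case: (g x).
- rewrite (_ : (fun x => _) =
    (fun x => complex.Re (f x) * complex.Im (g x) + complex.Im (f x) * complex.Re (g x))).
    by apply: measurable_funD; exact: measurable_funM.
  by apply/funext => x; case: (f x); case: (g x).
Qed.

Lemma cmeasurable_conj f : cmeasurable f -> cmeasurable (fun x => (f x)^*).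
Proof.
move=> [rf imf]; split.
- rewrite (_ : (fun x => _) = (fun x => complex.Re (f x))) //.
  by apply/funext => x; case: (f x).
- rewrite (_ : (fun x => _) = (fun x => - complex.Im (f x))); first exact: measurable_funN.
  by apply/funext => x; case: (f x).
Qed.

Lemma cmeasurable_sum (I : Type) (s : seq I) (F : I -> T -> C) :
  (forall i, cmeasurable (F i)) -> cmeasurable (fun x => \sum_(i <- s) F i x).
Proof.
move=> mF; elim: s => [|i s IH].
  rewrite (_ : (fun x => _) = fun _ => 0); first exact: cmeasurable_cst.
  by apply/funext => x; rewrite big_nil.
rewrite (_ : (fun x => _) = fun x => F i x + \sum_(i <- s) F i x); first exact: cmeasurableD.
by apply/funext => x; rewrite big_cons.
Qed.

Lemma measurable_cmeasurable_eq f (c : C) : cmeasurable f -> measurable [set x | f x = c].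
Proof.
move=> [rf imf]; rewrite (_ : [set _ | _] =
  (fun x => complex.Re (f x)) @^-1` [set complex.Re c] `&`
  (fun x => complex.Im (f x)) @^-1` [set complex.Im c]).
  apply: measurableI; rewrite -[X in measurable X]setTI; [exact: rf|exact: imf].
by apply/seteqP; split=> x /=; [move=> ->|case: (f x) c => a b [a' b'] /= [-> ->]].
Qed.

(** The order on [R[i]] requires equal imaginary parts, so the set is an intersection of two real
    conditions. *)
Lemma measurable_cmeasurable_lt f (c : C) : cmeasurable f -> measurable [set x | f x < c].
Proof.
move=> [rf imf]; rewrite (_ : [set _ | _] =
  (fun x => complex.Re (f x)) @^-1` `]-oo, complex.Re c[ `&`
  (fun x => complex.Im (f x)) @^-1` [set complex.Im c]).
  apply: measurableI; rewrite -[X in measurable X]setTI; [exact: rf|exact: imf].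
apply/seteqP; split=> x /=; rewrite ltcE in_itv /=.
  by move=> /andP[/eqP -> ->].
by move=> [-> ->]; rewrite eqxx.
Qed.

End ComplexMeasurable.

(** * Quadratic forms, fidelity and their measurability *)

Section QuadraticForms.
Variables (R : realType) (n : nat).
Local Notation C := R[i].
Implicit Types (A : 'M[C]_n) (v : 'cV[C]_n).

Definition form A v : C := (mxadj v *m A *m v) 0 0.

Lemma formE A v : form A v = \sum_j (\sum_i (v i 0)^* * A i j) * v j 0.
Proof.
rewrite /form mxE; apply: eq_bigr => j _; congr (_ * _).
by rewrite mxE; apply: eq_bigr => i _; rewrite mxadjE.
Qed.

Lemma form1E v : form 1%:M v = \sum_i (v i 0)^* * v i 0.
Proof.
rewrite /form mulmx1 mxE; apply: eq_bigr => i _.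
by rewrite mxadjE.
Qed.

Lemma form1_ge0 v : 0 <= form 1%:M v.
Proof. by rewrite form1E; apply: sumr_ge0 => i _; rewrite mulrC mul_conjC_ge0. Qed.

Lemma form_mul A (U : 'M[C]_n) v : form A (U *m v) = form (mxadj U *m A *m U) v.
Proof. by rewrite /form mxadjM !mulmxA. Qed.

Lemma form_proj_ge0 A v : mxadj A = A -> A *m A = A -> 0 <= form A v.
Proof.
move=> AA AM; suff -> : form A v = form 1%:M (A *m v) by exact: form1_ge0.
by rewrite form_mul mulmx1 AA AM.
Qed.

Lemma formB A B v : form (A - B) v = form A v - form B v.
Proof. by rewrite /form mulmxBr mulmxBl !mxE. Qed.

(** Both parts of the channel reduce to scalars on a rank-one operator: [Tr[Q v v^*] = <v|Q|v>], and
    the compressed part gives [<v|P|v>^2]. No normalization of [v] enters. *)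
Lemma fidelityE (P rho0 : 'M[C]_n) v :
  fidelity P rho0 v = form P v ^+ 2 + form (1%:M - P) v * form rho0 v.
Proof.
rewrite /fidelity /enc mulmxDr mulmxDl [LHS]mxE; congr (_ + _).
  rewrite !mulmxA -(mulmxA _ (mxadj v)) -(mulmxA _ _ v) [LHS]mxE big_ord1.
  by rewrite expr2 /form.
rewrite -scalemxAr -scalemxAl [LHS]mxE; congr (_ * _).
by rewrite mulmxA mxtrace_mulC mulmxA /mxtrace big_ord1.
Qed.

Lemma measurable_coord (i : 'I_n) : cmeasurable (fun v : vecT R n => (v : 'cV[C]_n) i 0).
Proof.
split=> _ A mA; rewrite setTI; apply: sub_sigma_algebra.
  by exists i, true, A.
by exists i, false, A.
Qed.

Lemma cmeasurable_form A : cmeasurable (fun v : vecT R n => form A v).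
Proof.
rewrite (_ : (fun v => _) =
  (fun v : vecT R n => \sum_j (\sum_i ((v : 'cV[C]_n) i 0)^* * A i j) * (v : 'cV[C]_n) j 0)).
  apply: cmeasurable_sum => j; apply: cmeasurableM; last exact: measurable_coord.
  apply: cmeasurable_sum => i; apply: cmeasurableM; last exact: cmeasurable_cst.
  exact/cmeasurable_conj/measurable_coord.
by apply/funext => v; rewrite formE.
Qed.

Lemma cmeasurable_fidelity (P rho0 : 'M[C]_n) :
  cmeasurable (fun v : vecT R n => fidelity P rho0 v).
Proof.
rewrite (_ : (fun v => _) = (fun v : vecT R n =>
  form P v * form P v + form (1%:M - P) v * form rho0 v)); last first.
  by apply/funext => v; rewrite fidelityE expr2.
by apply: cmeasurableD; apply: cmeasurableM; exact: cmeasurable_form.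
Qed.

Lemma measurable_mulmx (U : 'M[C]_n) :
  measurable_fun [set: vecT R n] ((fun v => U *m v) : vecT R n -> vecT R n).
Proof.
apply: (@measurability _ _ (vecT R n) (vecT R n) _ _ (@coord_gen R n)) => // _ [_ [i [b [A [mA ->]]]] <-].
have mU : cmeasurable (fun v : vecT R n => (U *m (v : 'cV[C]_n)) i 0).
  rewrite (_ : (fun v => _) = (fun v : vecT R n => \sum_j U i j * (v : 'cV[C]_n) j 0)).
    apply: cmeasurable_sum => j; apply: cmeasurableM; first exact: cmeasurable_cst.
    exact: measurable_coord.
  by apply/funext => v; rewrite mxE.
by case: mU => mRe mIm; case: b; [exact: mRe|exact: mIm].
Qed.

End QuadraticForms.

(** A positive multiple of an infinite value is infinite, so finiteness of [x] comes for free and no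
    integrability has to be shown beforehand. *)
Lemma mule_EFin_eq (R : realFieldType) (c e : R) (x : \bar R) :
  0 < c -> (c%:E * x)%E = e%:E -> x = (e / c)%:E.
Proof.
move=> c0; case: x => [r||]; rewrite ?gt0_muley ?gt0_muleNy ?lte_fin //.
by rewrite -EFinM => -[<-]; rewrite mulrAC divff ?mul1r // gt_eqF.
Qed.

Lemma sume_const (R : realFieldType) (I : finType) (x : \bar R) :
  (\sum_(i : I) x = #|I|%:R%:E * x)%E.
Proof. by rewrite mule_natl big_const iter_addr_0. Qed.

(** * Expectations under the unitarily invariant measure *)

Section UniformState.
Variables (R : realType) (n : nat) (mu : probability (vecT R n) R).
Hypothesis mu_unif : uniform_pure mu.
Local Notation C := R[i].
Local Notation T := (vecT R n).

(** Change of variables: the pushforward of [mu] under [U] agrees with [mu] on measurable sets. *)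
Lemma integral_unitary (U : 'M[C]_n) (f : T -> \bar R) : unitary U ->
  measurable_fun setT f -> (forall v, 0 <= f v)%E ->
  (\int[mu]_v f (U *m v : T) = \int[mu]_v f v)%E.
Proof.
move=> unitU mf f0; have [_ inv] := mu_unif.
pose phi : T -> T := fun v => U *m v.
have mphi : measurable_fun setT phi by exact: measurable_mulmx.
rewrite -[LHS](@ge0_integral_pushforward _ _ _ _ _ phi mphi mu setT f) //.
rewrite (eq_measure_integral mu) // => A mA _.
exact: inv.
Qed.

Definition rform (A : 'M[C]_n) (v : T) : R := complex.Re (form A v).

Lemma measurable_rform (A : 'M[C]_n) : measurable_fun setT (EFin \o rform A).
Proof. by apply/measurable_EFinP; case: (cmeasurable_form A). Qed.

Lemma measurable_sphere : measurable [set v : T | (mxadj v *m v) 0 0 = 1].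
Proof.
rewrite (_ : [set v | _] = [set v : T | form 1%:M v = 1]).
  exact/measurable_cmeasurable_eq/cmeasurable_form.
by apply/seteqP; split => v /=; rewrite /form mulmx1.
Qed.

Lemma sphere_null : mu (~` [set v : T | (mxadj v *m v) 0 0 = 1]) = 0%E.
Proof.
have [mu1 _] := mu_unif.
by rewrite probability_setC ?mu1 ?subee //; exact: measurable_sphere.
Qed.

Lemma integral_rform1 : (\int[mu]_v (rform 1%:M v)%:E = 1)%E.
Proof.
rewrite (@ge0_ae_eq_integral _ _ _ mu setT _ (cst 1%E)) //.
- by rewrite integral_cst // mul1e; exact: probability_setT.
- exact: measurable_rform.
- by move=> v _; rewrite lee_fin; have := form1_ge0 v; rewrite lecE => /andP[].
- exists (~` [set v : T | (mxadj v *m v) 0 0 = 1]); split.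
  + by apply: measurableC; exact: measurable_sphere.
  + exact: sphere_null.
  + move=> v /=; apply: contra_not => /= v1 _.
    by rewrite /rform /form mulmx1 v1.
Qed.

(** This is [|v_i|^2], put as a quadratic form so that [measurable_rform] applies. *)
Definition nrm2 (i : 'I_n) (v : T) : R := rform (delta_mx i i) v.

Lemma form_delta i (v : 'cV[C]_n) : form (delta_mx i i) v = (v i 0)^* * v i 0.
Proof.
rewrite formE (bigD1 i) //= [X in _ + X]big1 ?addr0; last first.
  move=> j ji; rewrite big1 ?mul0r // => k _.
  by rewrite mxE (negPf ji) andbF mulr0.
congr (_ * _); rewrite (bigD1 i) //= big1 ?addr0; last first.
  by move=> j ji; rewrite mxE (negPf ji) mulr0.
by rewrite mxE !eqxx mulr1.
Qed.

Lemma nrm2_ge0 i v : 0 <= nrm2 i v.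
Proof.
have : 0 <= form (delta_mx i i) v by rewrite form_delta mulrC mul_conjC_ge0.
by rewrite lecE => /andP[].
Qed.

Lemma Re_sum (I : finType) (F : I -> C) : complex.Re (\sum_i F i) = \sum_i complex.Re (F i).
Proof.
have ReD (x y : C) : complex.Re (x + y) = complex.Re x + complex.Re y by case: x; case: y.
exact: (big_morph (@complex.Re R) ReD erefl).
Qed.

Lemma rform1E v : rform 1%:M v = \sum_i nrm2 i v.
Proof.
by rewrite /rform form1E Re_sum; apply: eq_bigr => i _; rewrite /nrm2 /rform form_delta.
Qed.

Lemma unitary_perm (s : 'S_n) : unitary (perm_mx s : 'M[C]_n).
Proof.
rewrite /unitary (_ : mxadj _ = perm_mx s^-1%g); first by rewrite -perm_mxM mulVg perm_mx1.
by rewrite -tr_perm_mx /mxadj; congr trmx; apply/matrixP => i j; rewrite !mxE conjC_nat.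
Qed.

Lemma integral_nrm2_eq i j :
  (\int[mu]_v (nrm2 i v)%:E = \int[mu]_v (nrm2 j v)%:E)%E.
Proof.
rewrite -[RHS](integral_unitary (unitary_perm (tperm i j))).
- apply: eq_integral => v _; congr EFin; rewrite /nrm2 /rform !form_delta.
  by rewrite -row_permE mxE tpermR.
- exact: measurable_rform.
- by move=> v; rewrite lee_fin nrm2_ge0.
Qed.

(** The [n] coordinates have equal means, and these add up to the mean squared norm, which is 1. *)
Lemma integral_nrm2 i : (\int[mu]_v (nrm2 i v)%:E = (n%:R^-1)%:E)%E.
Proof.
have nr2 j : measurable_fun setT (fun v => (nrm2 j v)%:E) by exact: measurable_rform.
have : (\int[mu]_v (rform 1%:M v)%:E = \sum_(j < n) \int[mu]_v (nrm2 j v)%:E)%E.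
  rewrite -ge0_integral_sum //; last by move=> j v _; rewrite lee_fin nrm2_ge0.
  by apply: eq_integral => v _; rewrite sumEFin rform1E.
rewrite integral_rform1 (eq_bigr (fun=> \int[mu]_v (nrm2 i v)%:E)%E); last first.
  by move=> j _; exact: integral_nrm2_eq.
have n0 : 0 < n%:R :> R by case: n i => [[]|n' _] //; rewrite ltr0n.
rewrite sume_const card_ord => /esym/(mule_EFin_eq n0) ->.
by rewrite div1r.
Qed.

Definition sign_mx (s : {ffun 'I_n -> bool}) : 'M[C]_n := diag_mx (\row_i (-1) ^+ s i).

Lemma sign_mx_adj s : mxadj (sign_mx s) = sign_mx s.
Proof.
apply/matrixP => i j; rewrite mxadjE !mxE eq_sym.
by case: eqVneq => [->|_]; rewrite ?mulr0n ?conjC0 // !mulr1n rmorphXn rmorphN1.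
Qed.

Lemma unitary_sign s : unitary (sign_mx s).
Proof.
rewrite /unitary sign_mx_adj; apply/matrixP => i j; rewrite mul_diag_mx !mxE.
by case: eqVneq => [->|_]; rewrite ?mulr0n ?mulr0 // !mulr1n -expr2 sqrr_sign.
Qed.

(** For distinct [i] and [j], flipping the sign at [i] is an involution that negates every term. *)
Lemma sum_sign i j : \sum_(s : {ffun 'I_n -> bool}) (-1) ^+ s i * (-1) ^+ s j =
  (if i == j then (2 ^ n)%:R else 0) :> C.
Proof.
case: eqVneq => [->|ij].
  under eq_bigr do rewrite -expr2 sqrr_sign.
  by rewrite sumr_const card_ffun card_bool card_ord.
pose flip (s : {ffun 'I_n -> bool}) := [ffun k => if k == i then ~~ s k else s k].
have flipK : involutive flip.
  by move=> s; apply/ffunP => k; rewrite !ffunE; case: eqP => // _; rewrite negbK.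
set S := (LHS); have : S = - S.
  rewrite {1}/S (reindex_inj (inv_inj flipK)) /= -sumrN; apply: eq_bigr => s _.
  by rewrite !ffunE eqxx eq_sym (negPf ij) signrN mulNr.
by move/eqP; rewrite -addr_eq0 -mulr2n mulrn_eq0 /= => /eqP.
Qed.

Lemma sum_form_sign (A : 'M[C]_n) (v : 'cV[C]_n) :
  \sum_s form A (sign_mx s *m v) = (2 ^ n)%:R * \sum_i A i i * form (delta_mx i i) v.
Proof.
have formS s : form A (sign_mx s *m v) =
    \sum_j \sum_i (-1) ^+ s i * (-1) ^+ s j * ((v i 0)^* * A i j * v j 0).
  rewrite formE; apply: eq_bigr => j _; rewrite mulr_suml; apply: eq_bigr => i _.
  by rewrite /sign_mx mul_diag_mx !mxE rmorphM rmorphXn rmorphN1; ring.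
under eq_bigr do rewrite formS; rewrite exchange_big mulr_sumr /=.
apply: eq_bigr => j _; rewrite exchange_big (bigD1 j) //= [X in _ + X]big1 ?addr0.
  by rewrite -mulr_suml sum_sign eqxx form_delta; ring.
by move=> i ij; rewrite -mulr_suml sum_sign (negPf ij) mul0r.
Qed.

(* Averaging over the sign flips kills the off-diagonal entries of [A]; transpositions then
   make all the [|v_i|^2] have the same mean. *)
Lemma integral_rform (A : 'M[C]_n) : mxadj A = A -> A *m A = A ->
  (\int[mu]_v (rform A v)%:E = (complex.Re (\tr A) / n%:R)%:E)%E.
Proof.
(* Nonnegative diagonal entries, obtained by testing on basis vectors, allow the integral of the
   final sum to be split. *)
move=> Aadj AA; have A0 i : 0 <= complex.Re (A i i).
  have := form_proj_ge0 (delta_mx i 0) Aadj AA.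
  rewrite formE (bigD1 i) //= [X in _ + X]big1 ?addr0; last first.
    by move=> j ji; rewrite mxE (negPf ji) mulr0.
  rewrite (bigD1 i) //= [X in _ + X]big1 ?addr0; last first.
    by move=> j ji; rewrite mxE (negPf ji) conjC0 mul0r.
  by rewrite mxE !eqxx conjC1 mul1r mulr1 lecE => /andP[].
have A0' v : (0 <= (rform A v)%:E)%E.
  by have := form_proj_ge0 v Aadj AA; rewrite lee_fin lecE => /andP[].
have nr2 j : measurable_fun setT (fun v => (nrm2 j v)%:E) by exact: measurable_rform.
pose c : R := (2 ^ n)%:R; have c0 : 0 < c by rewrite ltr0n expn_gt0.
(* There are [c = 2 ^ n] sign patterns, each leaving the integral unchanged, so [c] times the
   integral is a sum over patterns. *)
suff : (c%:E * \int[mu]_v (rform A v)%:E = (c * (complex.Re (\tr A) / n%:R))%:E)%E.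
  by move/(mule_EFin_eq c0) => ->; rewrite mulrAC divff ?mul1r // gt_eqF.
transitivity (\sum_(s : {ffun 'I_n -> bool})
    \int[mu]_v (rform A (sign_mx s *m v : T))%:E)%E.
  rewrite (eq_bigr (fun=> \int[mu]_v (rform A v)%:E)%E); last first.
    move=> s _; apply: (integral_unitary (unitary_sign s) _ A0').
    exact: measurable_rform.
  by rewrite sume_const card_ffun card_bool card_ord.
rewrite -ge0_integral_sum //; last first.
  move=> s; rewrite (_ : (fun v => _) = (EFin \o rform (mxadj (sign_mx s) *m A *m sign_mx s))).
    exact: measurable_rform.
  by apply/funext => v /=; rewrite /rform form_mul.
transitivity (\int[mu]_v (\sum_(i < n) (c * complex.Re (A i i))%:E * (nrm2 i v)%:E))%E.
  apply: eq_integral => v _; rewrite sumEFin.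
  under [RHS]eq_bigr do rewrite -EFinM.
  rewrite sumEFin; congr EFin; rewrite -Re_sum sum_form_sign.
  rewrite mulr_sumr Re_sum; apply: eq_bigr => i _.
  have : 0 <= form (delta_mx i i) v by rewrite form_delta mulrC mul_conjC_ge0.
  (* Since [|v_i|^2] is real, the real part of its product with [A i i] is the product of the real
     parts. *)
  rewrite /nrm2 /rform lecE => /andP[/eqP im0 _].
  rewrite -(rmorph_nat (real_complex R)) -/c.
  case: (form _ v) im0 => a b /= ->; case: (A i i) => x y /=.
  by ring.
rewrite ge0_integral_sum //.
- rewrite (eq_bigr (fun i => (c * complex.Re (A i i) / n%:R)%:E)).
    rewrite sumEFin -mulr_suml -mulr_sumr /mxtrace Re_sum mulrA.
    by [].
  move=> i _; rewrite ge0_integralZl_EFin //.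
  + by rewrite integral_nrm2 -EFinM.
  + by move=> v _; rewrite lee_fin nrm2_ge0.
  + by rewrite mulr_ge0 // ltW.
- by move=> i; apply: measurable_funeM.
- by move=> i v _; rewrite mule_ge0 // lee_fin ?nrm2_ge0 // mulr_ge0 // ltW.
Qed.

End UniformState.

(** * Markov's inequality for the loss of fidelity *)

Section Markov.
Variables (R : realType) (n : nat) (mu : probability (vecT R n) R).
Hypothesis mu_unif : uniform_pure mu.
Local Notation C := R[i].
Local Notation T := (vecT R n).

(** With [q = <v|Q|v>] and [r = <v|rho0|v>], both nonnegative, the fidelity is
    [(1 - q)^2 + q r >= 1 - 2 q]. *)
Lemma fidelity_lt (P rho0 : 'M[C]_n) (W : 'cV[C]_n -> Prop) (eps : R) (v : 'cV[C]_n) :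
  orth_proj P W -> density rho0 -> (mxadj v *m v) 0 0 = 1 ->
  fidelity P rho0 v < ((1 - eps)%:C)%C -> eps / 2 <= rform (1%:M - P) v.
Proof.
move=> PW [_ rho_ge0 _] v1; rewrite fidelityE.
have QA := comp_proj_adj PW; have QQ := comp_proj_idem PW.
have formP : form P v = 1 - form (1%:M - P) v.
  by rewrite formB /form mulmx1 v1 opprB addrC subrK.
have := form_proj_ge0 v QA QQ; have : 0 <= form rho0 v := rho_ge0 v.
rewrite formP /rform; case: (form (1%:M - P) v) => q q'; case: (form rho0 v) => r r'.
rewrite !lecE /= => /andP[/eqP -> r0] /andP[/eqP -> q0].
rewrite ltcE expr2 /= => /andP[_ lt1].
have : 0 <= q * r by rewrite mulr_ge0.
have : 0 <= q * q by rewrite mulr_ge0.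
by move: lt1; rewrite ?(mul0r, mulr0, subr0, oppr0); nra.
Qed.

Lemma prob_fidelity_lt (P rho0 : 'M[C]_n) (W : 'cV[C]_n -> Prop) (eps : R) :
  0 < eps -> orth_proj P W -> density rho0 ->
  (mu [set psi : T | (fidelity P rho0 psi < ((1 - eps)%:C)%C)%R]
     <= (2 / eps * (complex.Re (\tr (1%:M - P)) / n%:R))%:E)%E.
Proof.
move=> eps0 PW rho.
have QA := comp_proj_adj PW; have QQ := comp_proj_idem PW.
have q0 (v : T) : 0 <= rform (1%:M - P) v.
  by have := form_proj_ge0 v QA QQ; rewrite lecE => /andP[].
have mq := measurable_rform (1%:M - P).
set E := [set psi | _]; set S := [set v : T | (mxadj v *m v) 0 0 = 1].
pose B := [set v : T | ((eps / 2)%:E <= `|(rform (1%:M - P) v)%:E|)%E].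
have mB : measurable B.
  rewrite (_ : B = setT `&` [set v : T | ((eps / 2)%:E <= (rform (1%:M - P) v)%:E)%E]).
    exact: emeasurable_fun_c_infty.
  by rewrite setTI; apply/seteqP; split=> v; rewrite /B /= ger0_norm.
have mE : measurable E := measurable_cmeasurable_lt _ (cmeasurable_fidelity P rho0).
have mS : measurable (~` S) by apply: measurableC; exact: measurable_sphere.
have nS : mu (~` S) = 0%E := sphere_null mu_unif.
(* [fidelity_lt] needs unit vectors; all others lie in a null set. *)
have sub : E `<=` ~` S `|` B.
  move=> v Ev; have [Sv|] := pselect (S v); last by left.
  by right; rewrite /B /= ger0_norm // lee_fin; exact: fidelity_lt PW rho Sv Ev.
apply: (@le_trans _ _ (mu B)).
  apply: le_trans (le_measure mu _ _ sub) _; rewrite ?inE //; first exact: measurableU.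
  have : (mu (~` S `|` B) <= mu (~` S) + mu B)%E by exact: measureU2.
  by rewrite nS add0e.
have e20 : 0 < eps / 2 by rewrite divr_gt0.
have := le_integral_abse mu measurableT mq e20; rewrite setTI.
have -> : (\int[mu]_v `|(EFin \o rform (1%:M - P)) v| =
           (complex.Re (\tr (1%:M - P)) / n%:R)%:E)%E.
  rewrite -(integral_rform mu_unif QA QQ); apply: eq_integral => v _.
  by rewrite gee0_abs ?lee_fin.
rewrite -[X in (X <= _)%E]/((eps / 2)%:E * mu B)%E => le1.
by rewrite -[2 / eps]invf_div EFinM lee_pdivlMl.
Qed.

End Markov.

Theorem theorem1 (R : realType) (K : nat) (J eps : R)
  (P rho0 : 'M[R[i]]_(2 ^ K)) (mu : probability (vecT R (2 ^ K)) R) :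
  (0 < K)%N -> ~~ odd K -> 0 <= J -> 0 < eps ->
  orth_proj P (in_HJ J) ->
  density rho0 -> (forall v, in_HJ J (rho0 *m v)) ->
  uniform_pure mu ->
  (mu [set psi : vecT R (2 ^ K) | (fidelity P rho0 psi < ((1 - eps)%:C)%C)%R]
     < ((2 * (K.+1)%:R / eps) * expR (- (2 * J ^+ 2) / K%:R))%:E)%E.
Proof.
move=> K0 Ke J0 eps0 PHJ rho _ mu_unif.
apply: le_lt_trans (prob_fidelity_lt mu_unif eps0 PHJ rho) _.
rewrite lte_fin (_ : 2 * _ / eps * _ =
  2 / eps * (K.+1%:R * expR (- (2 * J ^+ 2) / K%:R))); last by ring.
by rewrite ltr_pM2l ?divr_gt0 //; exact: mxtrace_comp_proj_lt.
Qed.
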